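(* Let $P$ be an Eulerian Sheffer poset whose binomial factorial function satisfies $B(0)=1$ and $B(n) = 2^{n-1}$ for $n \geq 1$, and let $C(n)$ be its coatom function. Then: (i) $C(3) \geq 2$, and every Sheffer interval of length $3$ is isomorphic to a poset of the form $P_{q_1,\ldots,q_r}$; (ii) $C(2m) = 2$ for all $m \geq 2$, and the two coatoms of a Sheffer interval of length $2m$ cover exactly the same elements of rank $2m-2$; (iii) for $m \geq 2$, $C(2m+1) = h$ is an even positive integer, and the set of $h$ coatoms of a Sheffer interval of length $2m+1$ can be partitioned into $h/2$ pairs $\{c_1,d_1\},\ldots,\{c_{h/2},d_{h/2}\}$ such that $c_i$ and $d_i$ cover the same two elements of rank $2m-1$.
   Context: All posets are locally finite with a unique minimal element $\hat 0$. A Sheffer poset is such a poset $P$ that (i) contains an infinite chain, (ii) has every interval graded (rank function $\rho$, $\rho(\hat0)=0$; $[x,y]$ is an $n$-interval if $\rho(y)-\rho(x)=n$), (iii) any two $n$-intervals $[\hat0,y]$, $[\hat0,v]$ with $y,v\neq\hat0$ have the same number $D(n)$ of maximal chains, and (iv) any two $n$-intervals $[x,y]$, $[u,v]$ with $x,u\neq\hat0$ have the same number $B(n)$ of maximal chains. Intervals $[\hat0,y]$ are Sheffer intervals; $B$ and $D$ are the binomial and Sheffer factorial functions. The coatom function is $C(n)=D(n)/D(n-1)$ (the number of coatoms of a Sheffer $n$-interval), with $C(1)=D(1)=1$. A poset is Eulerian if $\mu(x,y)=(-1)^{\rho(y)-\rho(x)}$ for all $x\le y$. For $q \geq 2$,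 $P_q$ is the face poset of a $q$-gon (empty face, $q$ vertices, $q$ edges, the whole polygon), a graded poset of rank $3$. For integers $q_1,\ldots,q_r \geq 2$, $P_{q_1,\ldots,q_r}$ is obtained from $P_{q_1},\ldots,P_{q_r}$ by identifying all their minimal elements into one and all their maximal elements into one. *)

(* Defs.v *)
From HB Require Import structures.
From mathcomp Require Import all_boot all_order all_algebra.
From mathcomp Require Import boolp classical_sets functions cardinality fsbigop.

Set Implicit Arguments.
Unset Strict Implicit.
Unset Printing Implicit Defensive.

Import Order.TTheory GRing.Theory Num.Theory.

Local Open Scope classical_set_scope.
Local Open Scope card_scope.
Local Open Scope order_scope.

(* The minimal element of the posets considered here is \bot; the interval
   [x, y] is the classical set `[x, y], which is empty unless x <= y. *)
Section Posets.
Context {d : Order.disp_t} {P : bPOrderType d}.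
Implicit Types (x y : P) (C : set P).

Definition is_chain C : Prop := total_on C (fun x y => x <= y).

Definition is_maximal_chain x y C : Prop :=
  [/\ C `<=` `[x, y], is_chain C &
      forall C', C' `<=` `[x, y] -> is_chain C' -> C `<=` C' -> C' = C].

Definition maximal_chains x y : set (set P) :=
  [set C | is_maximal_chain x y C].

Definition graded_interval x y : Prop :=
  forall C C', maximal_chains x y C -> maximal_chains x y C' -> C #= C'.

(* The common length (number of elements minus one) of the maximal chains of
   [\bot, x]; the default value 0 is never reached when this interval is
   finite and graded. *)
Definition rank x : nat :=
  xget 0%N [set n | forall C, maximal_chains \bot x C -> C #= `I_n.+1].

Definition is_n_interval (n : nat) x y : Prop :=
  x <= y /\ rank y = (rank x + n)%N.

Definition covered_by x y : Prop := x < y /\ forall z, ~ (x < z /\ z < y).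

Definition lower_covers y : set P := [set x | covered_by x y].

(* The coatoms of the interval [\bot, y]. *)
Definition coatoms y : set P := lower_covers y.

(* The values of mu at pairs with ~~ (x <= y) are irrelevant; the others are
   uniquely determined when P is locally finite. *)
Definition is_mobius_function (mu : P -> P -> int) : Prop :=
  (forall x, mu x x = 1%R) /\
  (forall x y, x < y -> mu x y = (- \sum_(z \in `[x, y[) mu x z)%R).

End Posets.

Section Sheffer.
Context {d : Order.disp_t} (P : bPOrderType d).

Definition locally_finite : Prop := forall x y : P, finite_set `[x, y].

Record sheffer_poset : Prop := ShefferPoset {
  sheffer_locally_finite : locally_finite;
  sheffer_infinite_chain : exists C : set P, is_chain C /\ infinite_set C;
  sheffer_graded : forall x y : P, x <= y -> graded_interval x y;
  sheffer_bottom_intervals : forall n (y v : P), y != \bot -> v != \bot ->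
    is_n_interval n \bot y -> is_n_interval n \bot v ->
    maximal_chains \bot y #= maximal_chains \bot v;
  sheffer_upper_intervals : forall n (x y u v : P), x != \bot -> u != \bot ->
    is_n_interval n x y -> is_n_interval n u v ->
    maximal_chains x y #= maximal_chains u v }.

Definition eulerian : Prop :=
  exists2 mu : P -> P -> int, is_mobius_function mu &
    forall x y, x <= y -> mu x y = ((-1) ^+ (rank y - rank x))%R.

Definition is_binomial_factorial (B : nat -> nat) : Prop :=
  forall n (x y : P), x != \bot -> is_n_interval n x y ->
    maximal_chains x y #= `I_(B n).

(* D 0 is left unconstrained. *)
Definition is_sheffer_factorial (D : nat -> nat) : Prop :=
  forall n (y : P), y != \bot -> is_n_interval n \bot y ->
    maximal_chains \bot y #= `I_(D n).

End Sheffer.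

(* Rational-valued, as the divisibility of D n by D (n - 1) is a fact about
   Sheffer posets; meaningful for n >= 1 only. *)
Definition coatom_function (D : nat -> nat) (n : nat) : rat :=
  if n == 1%N then 1%R else ((D n)%:R / (D n.-1)%:R)%R.

(* The disjoint union of a q_0-gon, ..., a q_(r-1)-gon, with their empty faces
   identified and their whole polygons identified.  A pair (i, j) names the
   j-th vertex, or the j-th edge, of the i-th polygon; the ends of the edge
   (i, j) are the vertices (i, j) and (i, j + 1 mod q_i).  The face poset of
   a single q-gon is the case r = 1. *)
Section Polygons.
Context {r : nat}.
Implicit Type q : 'I_r -> nat.

Definition poly_index q : Type := {i : 'I_r & 'I_(q i)}.

Variant polygons q :=
  | PEmpty
  | PVertex of poly_index q
  | PEdge of poly_index q
  | PWhole.

Arguments PEmpty {q}.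
Arguments PWhole {q}.

Definition next_index q (e : poly_index q) : poly_index q :=
  Tagged (fun i => 'I_(q i)) (ordS (tagged e)).

Definition polygons_le q (a b : polygons q) : bool :=
  match a, b with
  | PEmpty, _ => true
  | _, PWhole => true
  | PVertex v, PVertex w => v == w
  | PVertex v, PEdge e => (v == e) || (v == next_index e)
  | PEdge e, PEdge f => e == f
  | _, _ => false
  end.

Definition polygons_code q (a : polygons q) :
    bool + (poly_index q + poly_index q) :=
  match a with
  | PEmpty => inl false
  | PWhole => inl true
  | PVertex v => inr (inl v)
  | PEdge e => inr (inr e)
  end.

Definition polygons_decode q (c : bool + (poly_index q + poly_index q)) :
    polygons q :=
  match c with
  | inl false => PEmpty
  | inl true => PWhole
  | inr (inl v) => PVertex v
  | inr (inr e) => PEdge e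
  end.

Lemma polygons_codeK q : cancel (@polygons_code q) (@polygons_decode q).
Proof. by case. Qed.

HB.instance Definition _ q :=
  Choice.copy (polygons q) (can_type (@polygons_codeK q)).

Lemma polygons_le_refl q : reflexive (@polygons_le q).
Proof. by case=> //= v; rewrite eqxx. Qed.

Lemma polygons_le_anti q : antisymmetric (@polygons_le q).
Proof.
by case=> [|v|e|] [|w|f|] //=; rewrite ?andbF // => /andP[/eqP->].
Qed.

Lemma polygons_le_trans q : transitive (@polygons_le q).
Proof.
by case=> [|v|e|] [|w|f|] [|u|g|] //= => [/eqP-> | /eqP-> | h /eqP<- | /eqP->].
Qed.

Fact polygons_display : Order.disp_t. Proof. exact: Order.Disp tt tt. Qed.

HB.instance Definition _ q := Order.Le_isPOrder.Build polygons_display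
  (polygons q) (@polygons_le_refl q) (@polygons_le_anti q)
  (@polygons_le_trans q).

End Polygons.

Definition interval_isomorphic {d d' : Order.disp_t} {P : porderType d}
    (x y : P) (Q : porderType d') : Prop :=
  exists f : Q -> P, set_bij setT `[x, y] f /\ {mono f : a b / a <= b}.

(* Main.v *)
(* Away from the bottom, B(n) = 2^(n-1) forces every interval of length at least
   2 to have exactly two atoms and two coatoms, all of them comparable.  The
   vanishing of the alternating sum of the level sizes of [\bot, y], together
   with double counting between consecutive levels, then forces a Sheffer
   interval of even length to have exactly two coatoms.  A rank 2m-2 element of
   such an interval lies below two coatoms, hence below both; this is (ii).  In
   odd length 2m+1 the two elements covered by a coatom c cover a common z of
   rank 2m-2, and they are the two atoms of [z, y], so the other coatom above
   one of them covers the same two elements; this pairs the coatoms in (iii).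
   In length 3, vertices and edges form a graph in which every edge has two ends
   and every vertex lies on two edges, that is, a disjoint union of cycles.  As
   C(n) is the number of coatoms, (i)-(iii) also give the values of C. *)
Require Import Defs.
From mathcomp Require Import all_boot all_order all_algebra.
From mathcomp Require Import finmap.
From mathcomp Require Import boolp classical_sets functions cardinality fsbigop.
Import Order.TTheory GRing.Theory Num.Theory.

Set Implicit Arguments.
Unset Strict Implicit.
Unset Printing Implicit Defensive.

(** * Cardinalities, double counting and pairings of finite sets *)

Section Counting.
Local Open Scope classical_set_scope.
Local Open Scope card_scope.
Local Open Scope nat_scope.

(* Meaningful for finite sets only: an infinite set gets the value 0. *)
Definition ncard {T : choiceType} (A : set T) : nat := #|` fset_set A|.

Lemma ncard_setI_sum (T : choiceType) (A C : set T) : finite_set A ->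
  ncard (A `&` C) = \sum_(x <- fset_set A) (x \in C).
Proof.
move=> fA; have fAC : finite_set (A `&` C) by exact: sub_finite_set fA.
transitivity (\sum_(x <- fset_set A | x \in C) 1).
  rewrite -big_filter sum1_size; apply/perm_size/uniq_perm => //.
    by rewrite filter_uniq.
  by move=> x; rewrite mem_filter !in_fset_set // in_setI andbC.
by rewrite big_mkcond; apply: eq_bigr => x _; case: (x \in C).
Qed.

(** Both products count the pairs related by [r]: the two sides are the same double sum of
    indicators, with the order of summation exchanged. *)
Lemma double_count (T U : choiceType) (A : set T) (B : set U)
    (r : T -> U -> Prop) a b : finite_set A -> finite_set B ->
  (forall x, A x -> ncard (B `&` [set y | r x y]) = a) ->
  (forall y, B y -> ncard (A `&` [set x | r x y]) = b) ->
  ncard A * a = ncard B * b.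
Proof.
move=> fA fB hA hB.
have -> : ncard A * a =
    \sum_(x <- fset_set A) \sum_(y <- fset_set B) `[< r x y >].
  rewrite -[ncard A]sum1_size big_distrl big_seq [RHS]big_seq /=.
  apply: eq_bigr => x; rewrite in_fset_set // inE => /hA <-.
  by rewrite mul1n ncard_setI_sum //; apply: eq_bigr => y _; rewrite mem_setE.
rewrite exchange_big /= -[ncard B]sum1_size big_distrl big_seq [RHS]big_seq /=.
apply: eq_bigr => y; rewrite in_fset_set // inE => /hB <-.
by rewrite mul1n ncard_setI_sum //; apply: eq_bigr => x _; rewrite mem_setE.
Qed.

Lemma ncard_eq2 (T : choiceType) (A : set T) : finite_set A -> ncard A = 2 ->
  exists a b, a != b /\ A = [set a; b].
Proof.
move=> fA; rewrite /ncard => h.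
have [A0|[x xA]] := fset_0Vmem (fset_set A); first by rewrite A0 cardfs0 in h.
move: (h); rewrite (cardfsD1 x) xA => -[] /eqP /cardfs1P [y yE].
exists x, y; split.
  have : y \in (fset_set A `\ x)%fset by rewrite yE in_fset1.
  by rewrite in_fsetD1 eq_sym => /andP[].
apply: fset_set_inj => //.
by rewrite fset_setU1 // fset_set1 -yE fsetD1K.
Qed.

Lemma ncard1 (T : choiceType) (a : T) : ncard [set a] = 1.
Proof. by rewrite /ncard fset_set1 cardfs1. Qed.

Lemma ncard_lt (T : choiceType) (A C : set T) c :
  finite_set C -> A `<=` C -> C c -> ~ A c ->
  ncard A < ncard C.
Proof.
move=> fC AC Cc nAc; have fA : finite_set A by exact: sub_finite_set fC.
rewrite /ncard; apply: fproper_ltn_card; rewrite fproperE.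
apply/andP; split; first by rewrite -fset_set_sub.
by apply/negP; rewrite -fset_set_sub // => /(_ _ Cc).
Qed.

Lemma ncard_sub_eq (T : choiceType) (A C : set T) : finite_set C -> A `<=` C ->
  ncard A = ncard C -> A = C.
Proof.
move=> fC AC eAC; apply/seteqP; split=> // c Cc; apply: contrapT => nAc.
by have := ncard_lt fC AC Cc nAc; rewrite eAC ltnn.
Qed.

Lemma ncard_le (T : choiceType) (A C : set T) : finite_set C -> A `<=` C ->
  ncard A <= ncard C.
Proof.
move=> fC AC; apply: fsubset_leq_card; rewrite -fset_set_sub //.
exact: sub_finite_set fC.
Qed.

Lemma ncard2_other (T : choiceType) (A : set T) a : finite_set A ->
  ncard A = 2 -> A a -> exists2 b, b != a & A = [set a; b].
Proof.
move=> fA /(ncard_eq2 fA) [b [c [bc ->]]] [->|->].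
  by exists c; rewrite // eq_sym.
by exists b; rewrite // setUC.
Qed.

(** The representatives [c] are the elements that precede their image in the enumeration of [S]. As
    [tau] has no fixed point, it exchanges them with their complement, so they are half of [S]. *)
Lemma involution_pairs (S : finType) (tau : S -> S) :
  involutive tau -> (forall x, tau x <> x) ->
  ~~ odd #|S| /\ exists c : 'I_(#|S| %/ 2) -> S,
    [/\ injective c, forall i j, c i != tau (c j) &
        forall x, exists i, x = c i \/ x = tau (c i)].
Proof.
move=> tauK tauN; pose A := [pred x | enum_rank x < enum_rank (tau x)]%N.
have tauA x : (tau x \in A) = (x \notin A).
  rewrite !inE tauK -leqNgt [RHS]leq_eqVlt; case: eqP => //= /ord_inj/enum_rank_inj.
  by move/tauN.
have SE : #|S| = #|A|.*2.
  rewrite -(cardC A) -addnn; congr addn.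
  rewrite -[RHS](fintype.card_image (inv_inj tauK)); apply: eq_card => x.
  transitivity (tau x \in A); first by rewrite tauA.
  apply/idP/fintype.imageP => [xA|[z zA ->]].
    by exists (tau x); rewrite ?tauK.
  by rewrite tauK.
split; first by rewrite SE odd_double.
have hE : (#|S| %/ 2 = #|A|)%N by rewrite SE divn2 doubleK.
have cA i : enum_val (cast_ord hE i) \in A by exact: enum_valP.
exists (fun i => enum_val (cast_ord hE i)); split.
- by move=> i j /enum_val_inj /cast_ord_inj.
- by move=> i j; apply: contraTneq (cA i) => ->; rewrite tauA cA.
- have inA x : x \in A -> exists i, x = enum_val (cast_ord hE i).
    move=> xA; exists (cast_ord (esym hE) (enum_rank_in xA x)).
    by rewrite cast_ordKV enum_rankK_in.
  move=> x; have [/inA[i ->]|] := boolP (x \in A); first by exists i; left.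
  rewrite -tauA => /inA [i xi]; exists i; right.
  by rewrite -xi tauK.
Qed.

End Counting.

(** * Cycle decomposition of a graph whose vertices all have degree two *)

(* A flag is a vertex-edge pair of a graph in which every edge has two ends and
   every vertex lies on two edges; alpha and beta exchange the edge, resp. the
   vertex, of a flag.  Each cycle of the graph gives two orbits of
   alpha \o beta, its two orientations, and alpha exchanges them. *)
Section TwoRegularGraph.
Local Open Scope nat_scope.
Context {F : finType} {V E : eqType} {alpha beta : F -> F}.
Context {vertex : F -> V} {edge : F -> E}.
Hypothesis vertexP : forall x z, vertex z = vertex x <-> z = x \/ z = alpha x.
Hypothesis edgeP : forall x z, edge z = edge x <-> z = x \/ z = beta x.
Hypothesis alphaN : forall x, alpha x <> x.
Hypothesis betaN : forall x, beta x <> x.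
Hypothesis flag_inj : forall x z, vertex z = vertex x -> edge z = edge x -> z = x.

Lemma vertex_alpha x : vertex (alpha x) = vertex x.
Proof. by apply/vertexP; right. Qed.

Lemma edge_beta x : edge (beta x) = edge x.
Proof. by apply/edgeP; right. Qed.

Lemma alphaK : involutive alpha.
Proof.
by move=> x; have [/esym/alphaN|] := (vertexP _ _).1 (esym (vertex_alpha x)).
Qed.

Lemma betaK : involutive beta.
Proof.
by move=> x; have [/esym/betaN|] := (edgeP _ _).1 (esym (edge_beta x)).
Qed.

(** One step along a cycle: go to the other end of the edge, then to the other edge at that
    vertex. *)
Let turn x := alpha (beta x).

Lemma turn_inj : injective turn.
Proof. exact: inj_comp (inv_inj alphaK) (inv_inj betaK). Qed.

(** Conjugation by [alpha] inverts [turn]: it reverses the direction of travel. *)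
Lemma turn_alpha x : turn (alpha (turn x)) = alpha x.
Proof. by rewrite /turn alphaK betaK. Qed.

(** If [turn] fixed [x], then [alpha x = beta x] would share both vertex and edge with [x]. *)
Lemma turn_neq x : turn x != x.
Proof.
apply/eqP => tx; apply: (alphaN (x := x)); apply: flag_inj.
  exact: vertex_alpha.
by rewrite -{1}tx /turn alphaK edge_beta.
Qed.

Lemma iter_turn_alpha k x : iter k turn (alpha (iter k turn x)) = alpha x.
Proof. by elim: k => //= k IH; rewrite -iterS iterSr turn_alpha. Qed.

(** If [alpha x] were n turns away from [x], the flag y reached after [n./2] turns would satisfy
    [alpha y = y] or [alpha y = turn y], according to the parity of n. The first is a fixed point of
    [alpha], the second gives one of [beta]. *)
Lemma alpha_disconnected x : ~~ fconnect turn x (alpha x).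
Proof.
apply/negP => /iter_findex; set n := findex _ _ _ => nE.
have : alpha (iter n./2 turn x) = iter (odd n) turn (iter n./2 turn x).
  have iter_inj k : injective (iter k turn).
    by elim: k => //= k IH a b /turn_inj /IH.
  apply: (iter_inj n./2); rewrite iter_turn_alpha -nE -!iterD.
  by congr iter; rewrite -[LHS]odd_double_half addnAC addnn addnC.
case: (odd n) => /=; last exact: alphaN.
by rewrite /turn => /(inv_inj alphaK) /esym; exact: betaN.
Qed.

(** The two orbits over a cycle have distinct roots, so comparing these roots keeps exactly one of
    the two orientations. *)
Let oriented x :=
  enum_rank (fingraph.root (frel turn) x) <
  enum_rank (fingraph.root (frel turn) (alpha x)).

Let turn_sym : fingraph.connect_sym (frel turn) := fconnect_sym turn_inj.

Lemma oriented_turn x : oriented (turn x) = oriented x.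
Proof.
have root_turn u v : turn u = v ->
    fingraph.root (frel turn) v = fingraph.root (frel turn) u.
  by move=> <-; apply/esym/(fingraph.rootP turn_sym)/fconnect1.
by rewrite /oriented (root_turn x) // -(root_turn _ _ (turn_alpha x)).
Qed.

Lemma oriented_iter k x : oriented (iter k turn x) = oriented x.
Proof. by elim: k => //= k IH; rewrite oriented_turn. Qed.

Lemma oriented_alpha x : oriented (alpha x) = ~~ oriented x.
Proof.
rewrite /oriented alphaK -leqNgt [RHS]leq_eqVlt; case: eqP => //= e.
have /(fingraph.rootP turn_sym) := enum_rank_inj (ord_inj e).
by rewrite turn_sym (negPf (alpha_disconnected x)).
Qed.

Lemma oriented_beta x : oriented (beta x) = ~~ oriented x.
Proof. by rewrite -[beta x]alphaK oriented_alpha oriented_turn. Qed.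

(** A cycle is indexed by the root of its chosen orbit, and the flag (i, j) is reached from root i
    by j turns. The edge with index b then joins the vertices with indices b and [next_index b]. *)
Let cycle_roots := [pred x | froots turn x && oriented x].
Let root_of (i : 'I_#|cycle_roots|) : F := enum_val i.
Let len i := fingraph.order turn (root_of i).
Let flag (a : poly_index len) : F := iter (tagged a) turn (root_of (tag a)).

Lemma root_ofP i : froots turn (root_of i) /\ oriented (root_of i).
Proof. exact/andP/(enum_valP i). Qed.

Lemma oriented_flag a : oriented (flag a).
Proof. by rewrite /flag oriented_iter; case: (root_ofP (tag a)). Qed.

Lemma flag_injective : injective flag.
Proof.
move=> [i j] [i' j']; rewrite /flag /= => e.
have root_flag k n : fingraph.root (frel turn) (iter n turn (root_of k)) = root_of k.
  have [/eqP rk _] := root_ofP k; rewrite -[RHS]rk; apply/esym/(fingraph.rootP turn_sym).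
  exact: fconnect_iter.
have : root_of i = root_of i' by rewrite -(root_flag i j) e root_flag.
move=> /enum_val_inj ii'; case: i' / ii' j' e => j' e.
congr existT; apply: ord_inj.
by rewrite -(findex_iter (ltn_ord j)) e findex_iter.
Qed.

Lemma flag_surjective x : oriented x -> exists a, flag a = x.
Proof.
move=> ox; set z := fingraph.root (frel turn) x.
have xz : fconnect turn z x by rewrite turn_sym connect_root.
have zr : z \in cycle_roots.
  rewrite inE /= roots_root //= -(oriented_iter (findex turn z x)).
  by rewrite iter_findex.
have jP : findex turn z x < len (enum_rank_in zr z).
  by rewrite /len /root_of enum_rankK_in // findex_max.
exists (Tagged (fun i => 'I_(len i)) (Ordinal jP)).
by rewrite /flag /= /root_of enum_rankK_in // iter_findex.
Qed.

Lemma flag_next a : flag (next_index a) = turn (flag a).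
Proof.
case: a => i j; rewrite /flag /= -iterS.
have := ltn_ord j; rewrite leq_eqVlt => /predU1P[jE|jlt]; last by rewrite modn_small.
(* At the last index the walk closes up: [turn] iterated as often as the orbit has elements is the
   identity. *)
by rewrite jE modnn /= /len iter_order //; exact: turn_inj.
Qed.

Lemma len_ge2 i : 2 <= len i.
Proof.
rewrite leqNgt ltnS leq_eqVlt ltnS leqn0 orbC.
have := iter_order turn_inj (root_of i); rewrite -/(len i).
have : 0 < len i by exact: fingraph.order_gt0.
case: (len i) => [//|[|//]] _ /= /eqP.
by rewrite (negPf (turn_neq _)).
Qed.

(** Both [alpha] and [beta] reverse orientation, so exactly one of the two flags at a vertex, or on
    an edge, is oriented. The oriented flags therefore name every vertex once and every edge
    once. *)
Lemma two_regular_polygons (x0 : F) :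
  exists (r : nat) (q : 'I_r -> nat) (g : poly_index q -> F),
    [/\ 0 < r, forall i, 2 <= q i,
        injective (vertex \o g) /\ (forall x, exists a, vertex (g a) = vertex x),
        injective (edge \o g) /\ (forall x, exists a, edge (g a) = edge x) &
        forall a b, (exists x, vertex x = vertex (g a) /\ edge x = edge (g b))
          <-> a = b \/ a = next_index b].
Proof.
have vinj : injective (vertex \o flag).
  move=> a b /= /vertexP[/flag_injective//|e].
  by have := oriented_flag a; rewrite e oriented_alpha oriented_flag.
have vsurj x : exists a, vertex (flag a) = vertex x.
  have [/flag_surjective[a <-]|] := boolP (oriented x); first by exists a.
  rewrite -oriented_alpha => /flag_surjective[a ax]; exists a.
  by rewrite ax vertex_alpha.
exists #|cycle_roots|, len, flag; split=> //.
(* The flag [x0] provides at least one cycle. *)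
- by have [[i _] _] := vsurj x0; apply: leq_ltn_trans (ltn_ord i).
- exact: len_ge2.
- split=> [a b /= /edgeP[/flag_injective//|e]|x].
    by have := oriented_flag a; rewrite e oriented_beta oriented_flag.
  have [/flag_surjective[a <-]|] := boolP (oriented x); first by exists a.
  rewrite -oriented_beta => /flag_surjective[a ax]; exists a.
  by rewrite ax edge_beta.
- move=> a b; split=> [[x [xa /edgeP[xb|xb]]]|[->|->]].
  + by left; apply: vinj; rewrite /= -xa xb.
  + by right; apply: vinj; rewrite /= flag_next /turn vertex_alpha -xb.
  + by exists (flag b).
  (* The far end of edge b: [turn] and [beta] lead to the same vertex. *)
  + exists (beta (flag b)); rewrite edge_beta flag_next /turn.
    by rewrite vertex_alpha.
Qed.

End TwoRegularGraph.

(** * Maximal chains of an interval, cut at a coatom *)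

Section MaximalChains.
Local Open Scope classical_set_scope.
Local Open Scope order_scope.
Context {d : Order.disp_t} {P : bPOrderType d}.
Implicit Types (x y z c : P) (K : set P).

Definition interval_coatoms x y : set P := [set c | x <= c /\ covered_by c y].

Lemma chain_top K z : is_chain K -> (forall w, K w -> w <= z) ->
  is_chain (z |` K).
Proof.
move=> chK Kz u v [->|Ku] [->|Kv]; [by left | right | left | exact: chK].
- exact: Kz.
- exact: Kz.
Qed.

Lemma finite_chain_max K : finite_set K -> K !=set0 -> is_chain K ->
  exists c, K c /\ forall w, K w -> w <= c.
Proof.
move=> fK [x0 Kx0] chK.
have seq_max (s : seq P) : (forall w, w \in s -> K w) ->
    exists c, K c /\ forall w, w \in s -> w <= c.
  elim: s => [|a s IH] sK; first by exists x0.
  have [|c [Kc cmax]] := IH; first by move=> w ws; apply: sK; rewrite inE ws orbT.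
  have Ka : K a by apply: sK; rewrite inE eqxx.
  case: (chK _ _ Kc Ka) => ca.
    exists a; split=> // w; rewrite inE => /predU1P[->//|/cmax wc].
    exact: le_trans wc ca.
  by exists c; split=> // w; rewrite inE => /predU1P[->|/cmax].
have [|c [Kc cmax]] := seq_max (fset_set K).
  by move=> w; rewrite in_fset_set // inE.
by exists c; split=> // w Kw; apply: cmax; rewrite in_fset_set // inE.
Qed.

Lemma maximal_chain_sub x y K z : is_maximal_chain x y K -> K z -> x <= z <= y.
Proof. by case=> KI _ _ /KI; rewrite /= in_itv. Qed.

Lemma maximal_chain_mem x y K z : is_maximal_chain x y K -> x <= z <= y ->
  (forall w, K w -> w <= z \/ z <= w) -> K z.
Proof.
move=> [KI chK maxK] xzy cmp.
rewrite -(maxK (z |` K)); first by left.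
- by move=> w [->|/KI//]; rewrite /= in_itv.
- move=> u v [->|Ku] [->|Kv]; [by left | | | exact: chK].
  + by case: (cmp v Kv); [right|left].
  + exact: cmp.
- by move=> w; right.
Qed.

Lemma maximal_chain_top x y K : x <= y -> is_maximal_chain x y K -> K y.
Proof.
move=> xy mK; apply: (maximal_chain_mem mK); first by rewrite xy lexx.
by move=> w /(maximal_chain_sub mK) /andP[]; left.
Qed.

Lemma maximal_chain_bottom x y K : x <= y -> is_maximal_chain x y K -> K x.
Proof.
move=> xy mK; apply: (maximal_chain_mem mK); first by rewrite xy lexx.
by move=> w /(maximal_chain_sub mK) /andP[]; right.
Qed.

Lemma maximal_chain_extend x c y K : x <= c -> covered_by c y ->
  is_maximal_chain x c K -> is_maximal_chain x y (y |` K).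
Proof.
move=> xc [cy covc] mK; have Kc := maximal_chain_top xc mK.
have xy := le_trans xc (ltW cy).
have Ksub w : K w -> x <= w <= c by exact: maximal_chain_sub mK.
split.
- move=> w [->|/Ksub/andP[xw wc]]; rewrite /= in_itv /= ?xy ?lexx //.
  by rewrite xw (le_trans wc (ltW cy)).
- case: mK => _ chK _; apply: chain_top => // w /Ksub /andP[_ wc].
  exact: le_trans wc (ltW cy).
- move=> C' C'I chC' sub.
  apply/seteqP; split=> // w C'w.
  have [->|wy] := eqVneq w y; [by left | right].
  have C'wI : x <= w <= y by have := C'I _ C'w; rewrite /= in_itv.
  (* Elements of [C'] are comparable with [c], and nothing lies strictly between [c] and [y]. Hence
     [C'] without [y] is a chain of [x, c] containing [K], and maximality of [K] applies. *)
  have below v : C' v -> v != y -> v <= c.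
    move=> C'v vy; case: (chC' v c C'v (sub _ (or_intror Kc))) => // cv.
    have [->//|cv'] := eqVneq v c; case: (covc v); split.
      by rewrite lt_neqAle eq_sym cv'.
    by rewrite lt_neqAle vy; have := C'I _ C'v; rewrite /= in_itv => /andP[].
  suff KE : C' `\ y = K by rewrite -KE; split=> //= wE; rewrite wE eqxx in wy.
  case: (mK) => _ _; apply.
  + move=> v [C'v /eqP vy]; rewrite /= in_itv /= below // andbT.
    by have := C'I _ C'v; rewrite /= in_itv => /andP[].
  + by move=> u v [C'u _] [C'v _]; exact: chC'.
  + move=> v Kv; split; first by apply: sub; right.
    move=> /= vy; have /andP[_] := Ksub _ Kv.
    by rewrite vy (lt_geF cy).
Qed.

Lemma maximal_chain_restrict x y K : finite_set `[x, y] -> x < y ->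
  is_maximal_chain x y K ->
  exists c, interval_coatoms x y c /\ is_maximal_chain x c (K `\ y) /\ K c.
Proof.
move=> fxy xy mK; have [KI chK maxK] := mK.
have Ky := maximal_chain_top (ltW xy) mK.
have Kx := maximal_chain_bottom (ltW xy) mK.
(* The coatom is the maximum of [K] without [y]. An element strictly between it and [y] would be
   comparable with all of [K], hence in [K], against maximality. *)
have [|||c [[Kc /eqP cy] cmax]] := @finite_chain_max (K `\ y).
- by apply: sub_finite_set fxy => w [/KI].
- by exists x; split=> //= xey; rewrite xey ltxx in xy.
- by move=> u v [Ku _] [Kv _]; exact: chK.
have Ksub w : K w -> x <= w <= y by exact: maximal_chain_sub mK.
have /andP[xc cley] := Ksub _ Kc.
have clty : c < y by rewrite lt_neqAle cy.
exists c; split; [|split=> //].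
  split=> //; split=> // z [cz zy].
  have Kz : K z.
    apply: (maximal_chain_mem mK).
      by rewrite (le_trans xc (ltW cz)) ltW.
    move=> w Kw; have [->|wy] := eqVneq w y; first by right; exact: ltW.
    left; apply: le_trans (ltW cz); apply: cmax; split=> //.
    exact/eqP.
  have : z <= c.
    by apply: cmax; split=> //= zey; rewrite zey ltxx in zy.
  by rewrite (lt_geF cz).
split.
- move=> w Kw; rewrite /= in_itv /= cmax // andbT.
  by case: Kw => /Ksub /andP[].
- by move=> u v [Ku _] [Kv _]; exact: chK.
- move=> C' C'I chC' sub.
  have C'c w : C' w -> x <= w <= c by move=> /C'I; rewrite /= in_itv.
  have KE : y |` C' = K.
    apply: maxK.
    + move=> w [->|/C'c /andP[xw wc]]; rewrite /= in_itv /=.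
        by rewrite lexx ltW.
      by rewrite xw (le_trans wc).
    + apply: chain_top => // w /C'c /andP[_ wc]; exact: le_trans wc cley.
    + move=> w Kw; have [->|/eqP wy] := eqVneq w y; [by left | right].
      by apply: sub; split.
  rewrite -KE; apply/seteqP; split=> w.
    move=> C'w; split; first by right.
    move=> /= wy; have /andP[_] := C'c _ C'w.
    by rewrite wy (lt_geF clty).
  by move=> [[->|//] /=].
Qed.

(* Cutting a maximal chain of [x, y] just below y leaves a maximal chain of
   [x, c] for exactly one coatom c. *)
Lemma ncard_maximal_chains x y k : finite_set `[x, y] -> x < y ->
  finite_set (maximal_chains x y) ->
  (forall c, interval_coatoms x y c -> maximal_chains x c #= `I_k)%card ->
  ncard (maximal_chains x y) = (ncard (interval_coatoms x y) * k)%N.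
Proof.
move=> fxy xy fM hk.
have coatI c : interval_coatoms x y c -> x <= c /\ c < y.
  by case=> xc [].
have fcoat : finite_set (interval_coatoms x y).
  apply: sub_finite_set fxy => c /coatI[xc cy].
  by rewrite /= in_itv /= xc ltW.
rewrite -[LHS]muln1.
apply: (@double_count _ _ _ _ (fun K c => K c)) => // [K mK|c cc].
  have [c [cc [mKc Kc]]] := maximal_chain_restrict fxy xy mK.
  rewrite -(ncard1 c); congr ncard; apply/seteqP; split=> [c' /= [c'c Kc']|_ ->//].
  have [_ [c'y c'cov]] := c'c; have [_ [cy ccov]] := cc.
  have [_ chK _] := mK.
  case: (chK _ _ Kc Kc'); rewrite le_eqVlt => /orP[/eqP//|lt].
    by case: (ccov c').
  by case: (c'cov c).
have [xc cy] := coatI _ cc; have [_ cov] := cc.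
(* Adjoining [y] is a bijection from the maximal chains of [x, c] to those of [x, y] through [c]. *)
rewrite (_ : (_ `&` _)%classic =
    (fun K => y |` K) @` maximal_chains x c); last first.
  apply/seteqP; split=> [K [mK Kc]|K [K' mK' <-]].
    have [c' [cc' [mKc' Kc']]] := maximal_chain_restrict fxy xy mK.
    have c'E : c' = c.
      have [_ [c'y c'cov]] := cc'; have [cy' ccov] := cov.
      have [_ chK _] := mK.
      case: (chK _ _ Kc Kc'); rewrite le_eqVlt => /orP[/eqP//|lt].
        by case: (ccov c').
      by case: (c'cov c).
    exists (K `\ y); first by rewrite -c'E.
    by apply/setD1K/(maximal_chain_top (ltW xy) mK).
  split; first exact: maximal_chain_extend xc cov mK'.
  by right; exact: maximal_chain_top xc mK'.
rewrite /ncard; apply: card_fset_set.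
apply: card_eq_trans (hk _ cc); apply: inj_card_eq.
move=> K K' /[!inE] mK mK' KK'.
have cut (M : set P) : maximal_chains x c M -> (y |` M) `\ y = M.
  move=> mM; apply/seteqP; split=> w; first by move=> [[->|//] /=].
  move=> Mw; split; first by right.
  move=> /= wy; have /andP[_] := maximal_chain_sub mM Mw.
  by rewrite wy (lt_geF cy).
by rewrite -(cut K) // KK' cut.
Qed.

End MaximalChains.

(** * The rank function of a locally finite graded poset *)

Section Rank.
Local Open Scope classical_set_scope.
Local Open Scope order_scope.
Context {d : Order.disp_t} {P : bPOrderType d}.
Implicit Types (x y z c : P) (K : set P).
Hypothesis lfP : locally_finite P.

(** If [x] is not itself covered by [y], some z lies strictly between, and [z, y] is smaller than
    [x, y] since it misses [x]. *)
Lemma lower_cover_exists x y : x < y -> exists c, interval_coatoms x y c.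
Proof.
have [n] := ubnP (ncard `[x, y]); elim: n x => // n IH x xn xy.
have [cov|ncov] := pselect (covered_by x y); first by exists x.
have [z [xz zy]] : exists z, x < z /\ z < y.
  apply: contra_notP ncov => nz; split=> // z xzy.
  by apply: nz; exists z.
have [||c [zc cc]] := IH z; [|done|by exists c; split=> //; exact: le_trans (ltW xz) zc].
move: xn; rewrite ltnS; apply: leq_trans; apply: (@ncard_lt _ _ _ x) => //.
- move=> w; rewrite /= !in_itv /= => /andP[zw ->].
  by rewrite (le_trans (ltW xz)).
- by rewrite /= in_itv /= lexx ltW.
- by rewrite /= in_itv /= lt_geF.
Qed.

Lemma lower_ind (Q : P -> Prop) :
  (forall y, (forall z, z < y -> Q z) -> Q y) -> forall y, Q y.
Proof.
move=> HQ y; have [n] := ubnP (ncard `[\bot, y]).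
elim: n y => // n IH y yn; apply: HQ => z zy; apply: IH.
move: yn; rewrite ltnS; apply: leq_trans; apply: (@ncard_lt _ _ _ y) => //.
- move=> w; rewrite /= !in_itv /= => /andP[-> wz].
  by rewrite (le_trans wz) ?ltW.
- by rewrite /= in_itv /= lexx le0x.
- by rewrite /= in_itv /= le0x lt_geF.
Qed.

Lemma maximal_chain1 x : is_maximal_chain x x [set x].
Proof.
split.
- by move=> w ->; rewrite /= in_itv /= lexx.
- by move=> u v -> ->; left.
- move=> C' C'I _ sub; apply/seteqP; split=> // w /C'I.
  by rewrite /= in_itv /= => /le_anti ->.
Qed.

Lemma maximal_chain_exists x y : x <= y -> exists K, is_maximal_chain x y K.
Proof.
elim/lower_ind: y => y IH; rewrite le_eqVlt => /orP[/eqP <-|].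
  by exists [set x]; exact: maximal_chain1.
move=> /lower_cover_exists [c [xc cc]].
have [K mK] := IH c cc.1 xc.
by exists (y |` K); exact: maximal_chain_extend mK.
Qed.

Lemma finite_maximal_chain x y K : is_maximal_chain x y K -> finite_set K.
Proof. by case=> KI _ _; apply: sub_finite_set (lfP x y). Qed.

Hypothesis grP : forall x y, x <= y -> graded_interval x y.

(** Gradedness makes the set in the definition of [rank] nonempty, so the default value of [xget] is
    never taken. The successor is the passage from length to number of elements. *)
Lemma rank_maximal_chain y K : is_maximal_chain \bot y K ->
  ncard K = (rank y).+1.
Proof.
move=> mK; apply: card_fset_set; rewrite /rank.
have fK := finite_maximal_chain mK.
have Kgt0 : (0 < ncard K)%N.
  rewrite /ncard cardfs_gt0; apply/eqP => K0.
  have := maximal_chain_top (le0x y) mK.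
  by rewrite (fset_set_set0 fK K0).
suff : [set n | forall C, maximal_chains \bot y C -> (C #= `I_n.+1)%card]
         (ncard K).-1.
  by move=> /(@xgetI _ 0%N); apply.
move=> C mC /=; rewrite prednK //.
apply: card_eq_trans (grP (le0x y) mC mK) _.
by rewrite -[X in (X #= _)%card]fset_setK //; exact/card_eq_fsetP.
Qed.

Lemma rank_covered c y : covered_by c y -> rank y = (rank c).+1.
Proof.
move=> cov; have [K mK] := maximal_chain_exists (le0x c).
apply: succn_inj; rewrite -(rank_maximal_chain mK).
rewrite -(rank_maximal_chain (maximal_chain_extend (le0x c) cov mK)).
have fK := finite_maximal_chain mK.
rewrite /ncard fset_setU1 // cardfsU1 in_fset_set //.
rewrite (_ : y \notin K) // notin_setE => /(maximal_chain_sub mK) /andP[_].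
by rewrite lt_geF //; case: cov.
Qed.

Lemma rank_bot : rank (\bot : P) = 0%N.
Proof.
apply: succn_inj; rewrite -(rank_maximal_chain (maximal_chain1 \bot)).
exact: ncard1.
Qed.

Lemma rank_le x y : x <= y -> (rank x <= rank y)%N.
Proof.
elim/lower_ind: y => y IH; rewrite le_eqVlt => /orP[/eqP->//|].
move=> /lower_cover_exists [c [xc cc]].
by rewrite (rank_covered cc) ltnW // ltnS; apply: IH => //; case: cc.
Qed.

Lemma rank_lt x y : x < y -> (rank x < rank y)%N.
Proof.
move=> /lower_cover_exists [c [xc cc]].
by rewrite (rank_covered cc) ltnS rank_le.
Qed.

Lemma rank_eq x y : x <= y -> rank x = rank y -> x = y.
Proof.
rewrite le_eqVlt => /orP[/eqP//|/rank_lt + xy].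
by rewrite xy ltnn.
Qed.

Lemma covered_byP x y : covered_by x y <-> x <= y /\ rank y = (rank x).+1.
Proof.
split=> [cov|[xy rxy]]; first by split; [case: cov => /ltW | exact: rank_covered].
split=> [|z [/rank_lt xz /rank_lt zy]].
  by rewrite lt_neqAle xy andbT; apply/eqP => xey; move: rxy; rewrite xey => /n_Sn.
by move: (leq_ltn_trans xz zy); rewrite rxy ltnn.
Qed.

Lemma exists_below y n : (n <= rank y)%N -> exists2 x, x <= y & rank x = n.
Proof.
elim/lower_ind: y => y IH; rewrite leq_eqVlt => /predU1P[->|]; first by exists y.
move=> ny; have : \bot < y.
  rewrite lt_neqAle le0x andbT; apply/eqP => y0.
  by move: ny; rewrite -y0 rank_bot.
move=> /lower_cover_exists [c [_ cc]]; have [cy _] := cc.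
have [|x xc xn] := IH c cy; first by rewrite -ltnS -(rank_covered cc).
by exists x => //; exact: le_trans xc (ltW cy).
Qed.

(** Rank is injective on a chain, so the ranks along an infinite chain are unbounded; from an
    element of rank at least [n] one descends to rank [n]. *)
Lemma exists_rank n : (exists C : set P, is_chain C /\ infinite_set C) ->
  exists y, rank y = n.
Proof.
move=> [C [chC infC]].
have [y ny] : exists y, (n <= rank y)%N.
  have [S SC nS] := infinite_set_fset n.+1 infC.
  apply: contrapT => small.
  have : (size [seq rank x | x <- S] <= size (iota 0 n))%N.
    apply: uniq_leq_size => [|_ /mapP[x _ ->]].
      rewrite map_inj_in_uniq ?fset_uniq // => x x' /SC Cx /SC Cx' rxx'.
      by case: (chC _ _ Cx Cx') => /rank_eq -> //.
    rewrite mem_iota /= ltnNge; apply/negP => h; apply: small; by exists x.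
  by rewrite size_map size_iota leqNgt nS.
by have [x _ xn] := exists_below ny; exists x.
Qed.

End Rank.

(** * Levels of intervals in an Eulerian Sheffer poset with B(n) = 2^(n-1) *)

Section EulerianSheffer.
Local Open Scope classical_set_scope.
Local Open Scope card_scope.
Local Open Scope order_scope.
Context {d : Order.disp_t} {P : bPOrderType d} {B D : nat -> nat}.
Implicit Types (x y z c : P) (K : set P).
Hypothesis shP : sheffer_poset P.
Hypothesis euP : eulerian P.
Hypothesis binB : is_binomial_factorial P B.
Hypothesis shD : is_sheffer_factorial P D.
Hypothesis Bexp : forall n, (1 <= n)%N -> B n = (2 ^ (n - 1))%N.

Let lfP := sheffer_locally_finite shP.
Let grP := sheffer_graded shP.

(** Atoms and coatoms of an interval are both levels, which gives the counts from below and from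
    above a common form. *)
Definition level x y k : set P := [set z | x <= z <= y /\ rank z = k].

Lemma finite_level x y k : finite_set (level x y k).
Proof.
by apply: sub_finite_set (lfP x y) => z [xzy _]; rewrite /= in_itv.
Qed.

Lemma interval_coatomsE x y k : rank y = k.+1 ->
  interval_coatoms x y = level x y k.
Proof.
move=> ry; apply/seteqP; split=> [c [xc cov]|c [/andP[xc cy] rc]].
  have /(covered_byP lfP grP) [cy] := cov.
  by rewrite ry => -[->]; split=> //; rewrite xc.
by split=> //; apply/(covered_byP lfP grP); rewrite ry rc.
Qed.

Lemma coatomsE y k : rank y = k.+1 -> coatoms y = level \bot y k.
Proof.
move=> ry; rewrite -interval_coatomsE //; apply/seteqP.
by split=> c; [split; rewrite ?le0x | case].
Qed.

Lemma rank_gt0 y : (0 < rank y)%N -> y != \bot.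
Proof. by apply: contraTneq => ->; rewrite (rank_bot lfP grP). Qed.

Lemma upper_maximal_chains n x y : x != \bot -> x <= y ->
  rank y = (rank x + n)%N -> maximal_chains x y #= `I_(B n).
Proof. by move=> x0 xy ry; apply: binB. Qed.

(** An interval of length n + 2 has 2^(n+1) maximal chains, of which 2^n pass through each
    coatom. *)
Lemma ncard_upper_coatoms x y k : x != \bot -> x <= y ->
  (rank x < k)%N -> rank y = k.+1 -> ncard (level x y k) = 2.
Proof.
move=> x0 xy xk ry; rewrite -(interval_coatomsE x ry).
have [n kE] : exists n, k = (rank x + n.+1)%N.
  by exists (k - rank x).-1; rewrite prednK ?subn_gt0 // subnKC // ltnW.
have xlty : x < y.
  by rewrite lt_neqAle xy andbT; apply/eqP => xey; move: xk; rewrite xey ry ltnNge leqnSn.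
have hM : maximal_chains x y #= `I_(2 ^ n.+1).
  have -> : (2 ^ n.+1 = B n.+2)%N by rewrite Bexp // subSS subn0.
  by apply: upper_maximal_chains => //; rewrite ry kE !addnS.
have fM : finite_set (maximal_chains x y) by apply/finite_setP; eexists; exact: hM.
have := ncard_maximal_chains (k := (2 ^ n)%N) (lfP x y) xlty fM.
rewrite {1}/ncard (card_fset_set hM) expnS => /(_ _)/eqP.
rewrite eqn_pmul2r ?expn_gt0 // => h; symmetry; apply/eqP/h => c cc.
have [xc _] := cc; move: cc; rewrite (interval_coatomsE x ry) => -[_ rc].
have -> : (2 ^ n = B n.+1)%N by rewrite Bexp // subSS subn0.
by apply: upper_maximal_chains => //; rewrite rc.
Qed.

(** The coatoms of [z, y] are among those of [x, y], and both intervals have two, so every coatom of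
    [x, y] is above [z]. *)
Lemma upper_level_below x y z c k : x != \bot -> x <= z -> z <= y ->
  (rank z < k)%N -> rank y = k.+1 -> level x y k c -> z <= c.
Proof.
move=> x0 xz zy zk ry cc.
have z0 : z != \bot by apply: contraNneq x0 => z0; move: xz; rewrite z0 lex0.
have xk : (rank x < k)%N by exact: leq_ltn_trans (rank_le lfP grP xz) zk.
have sub : level z y k `<=` level x y k.
  by move=> w [/andP[zw wy] rw]; split=> //; rewrite (le_trans xz zw).
have e : level z y k = level x y k.
  apply: ncard_sub_eq (finite_level _ _ _) sub _.
  by rewrite !ncard_upper_coatoms // (le_trans xz).
by move: cc; rewrite -e => -[/andP[]].
Qed.

(** In length 2 the atoms are the coatoms. In greater length every atom lies below any chosen coatom
    c, so [x, y] has the same atoms as [x, c], and induction applies. *)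
Lemma ncard_upper_atoms x y : x != \bot -> x <= y ->
  ((rank x).+1 < rank y)%N -> ncard (level x y (rank x).+1) = 2.
Proof.
move=> x0; elim/(lower_ind lfP): y => y IH xy.
rewrite leq_eqVlt => /predU1P[ry|]; first by apply: ncard_upper_coatoms.
case E : (rank y) => [//|k]; rewrite ltnS => xk.
have [c cc] : exists c, interval_coatoms x y c.
  apply: (lower_cover_exists lfP).
  rewrite lt_neqAle xy andbT; apply/eqP => xey; move: xk.
  by rewrite xey E => /ltnW /ltnW; rewrite ltnn.
have [xc [cy _]] := cc; move: cc; rewrite (interval_coatomsE x E) => cc.
have [_ rc] := cc.
rewrite -(IH c cy xc); last by rewrite rc.
congr ncard; apply/seteqP; split=> z [/andP[xz zy] rz]; split=> //.
  rewrite xz; apply: (upper_level_below x0 xz zy _ E cc).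
  by rewrite rz.
by rewrite xz (le_trans zy) // ltW.
Qed.

(** This is the recursion for [mu \bot y], with every value of [mu] replaced by its Eulerian
    sign. *)
Lemma euler_sum y : y != \bot ->
  (\sum_(z <- fset_set `[\bot, y]) (-1) ^+ rank z = 0%R :> int)%R.
Proof.
move=> y0; have [mu [_ muE] euE] := euP.
have bot_lt : \bot < y by rewrite lt_neqAle le0x eq_sym y0.
have fI : finite_set `[\bot, y[.
  apply: sub_finite_set (lfP \bot y) => z; rewrite /= !in_itv /= => /andP[-> /ltW].
  by [].
have eI : `[\bot, y]%classic = y |` `[\bot, y[%classic.
  apply/seteqP; split=> z; rewrite /= !in_itv /= !le0x /=.
    by rewrite le_eqVlt => /predU1P.
  by case=> [->//|/ltW].
rewrite eI fset_setU1 // big_fsetU1 /=; last first.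
  by rewrite in_fset_set // notin_setE /= in_itv /= ltxx andbF.
have := muE _ _ bot_lt; rewrite euE // (rank_bot lfP grP) subn0 fsbig_finite //= => ->.
rewrite addrC; apply/eqP; rewrite subr_eq0; apply/eqP.
rewrite big_seq [RHS]big_seq; apply: eq_bigr => z _.
by rewrite euE ?le0x // (rank_bot lfP grP) subn0.
Qed.

Lemma level_setI y k : level \bot y k = (`[\bot, y] `&` [set z | rank z = k])%classic.
Proof. by apply/seteqP; split=> z [] /=; rewrite in_itv. Qed.

Lemma euler_levels y : y != \bot ->
  (\sum_(0 <= k < (rank y).+1) (-1) ^+ k * (ncard (level \bot y k))%:Z = 0)%R.
Proof.
move=> y0; rewrite -[RHS](euler_sum y0) big_mkord.
(* Each level size becomes a sum of indicators over [\bot, y]; after exchanging the sums, only the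
   term [k = rank z] survives. *)
under eq_bigr => k _.
  rewrite level_setI ncard_setI_sum // -natz natr_sum big_distrr /=.
  over.
rewrite exchange_big /= big_seq [RHS]big_seq; apply: eq_bigr => z.
rewrite in_fset_set // inE /= in_itv /= => /andP[_ zy].
have zk : (rank z < (rank y).+1)%N by rewrite ltnS (rank_le lfP grP).
rewrite (bigD1 (Ordinal zk)) //= big1 ?addr0 => [|k kz].
  by rewrite mem_set // mulr1.
rewrite memNset ?mulr0 //= => rz.
by case/eqP: kz; exact/val_inj.
Qed.

Lemma level0 y : level \bot y 0 = [set \bot].
Proof.
apply/seteqP; split=> [z [_ rz]|z ->] /=; last first.
  by split; rewrite ?le0x ?(rank_bot lfP grP).
by symmetry; apply: (rank_eq lfP grP); rewrite ?le0x // (rank_bot lfP grP).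
Qed.

Lemma level_top y : level \bot y (rank y) = [set y].
Proof.
apply/seteqP; split=> [z [/andP[_ zy] rz]|z ->] /=; last first.
  by split; rewrite ?le0x ?lexx.
exact: (rank_eq lfP grP zy).
Qed.

(* In a Sheffer 2m-interval every element of odd rank 2j - 1 < 2m - 1 is
   covered by two elements, and by induction every element of rank 2j < 2m
   covers two, so the levels 2j - 1 and 2j cancel in the Euler sum. *)
Lemma ncard_even_coatoms m y : rank y = m.+1.*2 ->
  ncard (level \bot y m.*2.+1) = 2.
Proof.
elim/ltn_ind: m y => m IH y ry.
have y0 : y != \bot by rewrite rank_gt0 ?ry.
set N := fun k => ncard (level \bot y k).
have pairs j : (j < m)%N -> N j.*2.+1 = N j.*2.+2.
  move=> jm; apply/eqP; rewrite -(eqn_pmul2r (m := 2)) //; apply/eqP.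
  apply: (@double_count _ _ _ _ (fun a b => a <= b)); try exact: finite_level.
    move=> a [/andP[_ ay] ra].
    rewrite -(@ncard_upper_atoms a y) ?rank_gt0 ?ra ?ry ?doubleS ?ltnS //.
    - congr ncard; apply/seteqP; split=> [b [[/andP[_ yb] rb] ab]|b [/andP[ab yb] rb]].
        by split; rewrite // ab.
      by split=> //; split; rewrite ?le0x.
    - by rewrite ltn_double.
  move=> b [/andP[_ yb] rb].
  rewrite -(IH j jm b) ?rb //.
  congr ncard; apply/seteqP; split=> [a [[/andP[_ ya] ra] ab]|a [/andP[_ ab] ra]].
    by split; rewrite // le0x.
  by split=> //; split; rewrite ?le0x ?(le_trans ab).
have sign_even j : ((-1) ^+ j.*2 = 1 :> int)%R by rewrite -signr_odd odd_double.
have partial j : (j <= m)%N ->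
    (\sum_(0 <= k < j.*2.+1) (-1) ^+ k * (N k)%:Z = 1)%R.
  elim: j => [|j IHj] jm.
    by rewrite big_nat1 expr0 mul1r /N level0 ncard1.
  rewrite doubleS big_nat_recr //= big_nat_recr //= IHj 1?ltnW // -pairs //.
  by rewrite !exprS sign_even mulr1 !mulN1r opprK mul1r addrNK.
(* After the cancellations the Euler sum reads 1 - N(2m+1) + 1 = 0, with [m] as in the statement;
   the last 1 is [y] itself. *)
have := euler_levels y0; rewrite ry doubleS big_nat_recr //= big_nat_recr //= partial //.
rewrite -/(N _) -/(N _) !exprS sign_even mulr1 !mulN1r opprK mul1r.
rewrite /N -doubleS -ry level_top ncard1.
by move=> /eqP; rewrite addrAC subr_eq0 => /eqP [].
Qed.

(** Sorting maximal chains by their coatom gives D(n+2) as the number of coatoms times D(n+1). The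
    index [n.+2] stays clear of the special value at 1. *)
Lemma coatom_function_ncard n y : rank y = n.+2 ->
  coatom_function D n.+2 = ((ncard (coatoms y))%:R)%R.
Proof.
move=> ry; rewrite /coatom_function /= (coatomsE ry) -(interval_coatomsE _ ry).
have y0 : y != \bot by rewrite rank_gt0 ?ry.
have bot_lt : \bot < y by rewrite lt_neqAle le0x eq_sym y0.
have hD k z : rank z = k.+1 -> maximal_chains \bot z #= `I_(D k.+1).
  move=> rz; apply: shD; first by rewrite rank_gt0 ?rz.
  by split; rewrite ?le0x // (rank_bot lfP grP).
have fM : finite_set (maximal_chains \bot y).
  by apply/finite_setP; eexists; exact: hD ry.
have := ncard_maximal_chains (k := D n.+1) (lfP \bot y) bot_lt fM.
rewrite {1}/ncard (card_fset_set (hD _ _ ry)) => ->; last first.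
  by move=> c; rewrite (interval_coatomsE _ ry) => -[_ rc]; exact: hD.
rewrite natrM mulfK // pnatr_eq0.
have [c [_ cc]] := lower_cover_exists lfP bot_lt.
have rc : rank c = n.+1.
  by apply: succn_inj; rewrite -ry (rank_covered lfP grP cc).
have [K mK] := maximal_chain_exists lfP (le0x c).
(* The quotient is genuine: D(n+1) counts the maximal chains below the coatom [c], and [K] is one of
   them. *)
apply/eqP => D0; have := hD _ _ rc; rewrite D0 => /card_fset_set /cardfs0_eq.
move=> /fset_set_set0 M0; suff : set0 K by [].
by rewrite -M0 //; apply/finite_setP; eexists; exact: hD rc.
Qed.

Lemma level_upper_bottom x y k : x != \bot -> x <= y ->
  (rank x < k)%N -> rank y = k.+1 -> level x y k `<=` level \bot y k.
Proof. by move=> x0 xy xk ry z [/andP[xz zy] rz]; rewrite /level /= le0x. Qed.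

(** The element [z] has rank 2k > 0, so [z, y] is an upper interval with two coatoms. These exhaust
    the two coatoms of [\bot, y], so [c'] is above [z]. *)
Lemma even_coatoms_share k y c c' z : (0 < k)%N -> rank y = k.+1.*2 ->
  coatoms y c -> coatoms y c' -> covered_by z c -> covered_by z c'.
Proof.
move=> k0 ry; rewrite (coatomsE (k := k.*2.+1)) // => -[/andP[_ cy] rc] c'y.
move=> /(covered_byP lfP grP) [zc rcz]; apply/(covered_byP lfP grP).
have rz : rank z = k.*2 by apply: succn_inj; rewrite -rcz rc.
have z0 : z != \bot by rewrite rank_gt0 // rz double_gt0.
have [_ ->] := c'y; rewrite rz; split=> //.
have zy : z <= y by exact: le_trans zc cy.
have zk : (rank z < k.*2.+1)%N by rewrite rz.
have sub := level_upper_bottom z0 zy zk ry.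
move: c'y; rewrite -(ncard_sub_eq (finite_level _ _ _) sub) => [[/andP[]]//|].
by rewrite ncard_upper_coatoms // ncard_even_coatoms.
Qed.

Lemma even_coatoms k y : (0 < k)%N -> rank y = k.+1.*2 ->
  exists c c', [/\ c != c', coatoms y = [set c; c'] &
    forall z, covered_by z c <-> covered_by z c'].
Proof.
move=> k0 ry; have cE := coatomsE (k := k.*2.+1) ry.
have [c [c' [cc' cE']]] := ncard_eq2 (finite_level \bot y _) (ncard_even_coatoms ry).
exists c, c'; split=> //; first by rewrite cE cE'.
have cc : coatoms y c by rewrite cE cE'; left.
have cc'' : coatoms y c' by rewrite cE cE'; right.
move=> z; split; first exact: even_coatoms_share k0 ry cc cc''.
exact: even_coatoms_share k0 ry cc'' cc.
Qed.

(* Take z covered by a.  By the even case z is covered by both a and b and by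
   both elements covered by c', while [z, y] has only two atoms. *)
Lemma odd_coatom_twin k y c : (0 < k)%N -> rank y = k.+1.*2.+1 ->
  coatoms y c -> exists c' a b,
    [/\ c' != c, coatoms y c', a != b /\ lower_covers c = [set a; b],
        lower_covers c' = [set a; b] &
        forall e, coatoms y e -> lower_covers e = [set a; b] -> e = c \/ e = c'].
Proof.
move=> k0 ry; rewrite (coatomsE ry) => -[/andP[_ cy] rc].
have lE e : rank e = k.+1.*2 -> lower_covers e = level \bot e k.*2.+1.
  by move=> re; rewrite -coatomsE.
have [a [b [ab cE]]] := ncard_eq2 (finite_level \bot c _) (ncard_even_coatoms rc).
have [/andP[_ ac] ra] : level \bot c k.*2.+1 a by rewrite cE; left.
have a0 : a != \bot by rewrite rank_gt0 ?ra.
have ay : a <= y by exact: le_trans ac cy.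
have cay : level a y k.+1.*2 c by split; rewrite ?ac.
have nay : ncard (level a y k.+1.*2) = 2.
  by rewrite ncard_upper_coatoms // ra doubleS.
(* The twin of [c] is the other coatom of [a, y]. *)
have [c' c'c ayE] := ncard2_other (finite_level _ _ _) nay cay.
have [/andP[ac' c'y] rc'] : level a y k.+1.*2 c' by rewrite ayE; right.
have [z za] : exists z, covered_by z a.
  have [|z [_ za]] := @lower_cover_exists _ _ lfP \bot a; last by exists z.
  by rewrite lt_neqAle le0x eq_sym a0.
have /(covered_byP lfP grP) [zlea raz] := za.
have rz : rank z = k.*2 by apply: succn_inj; rewrite -raz.
have z0 : z != \bot by rewrite rank_gt0 // rz double_gt0.
have zy : z <= y by exact: le_trans zlea ay.
have nzy : ncard (level z y (rank z).+1) = 2.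
  by apply: ncard_upper_atoms => //; rewrite rz ry doubleS.
(* Inside [\bot, e], of even length, [a] and [w] are coatoms and so cover the same elements; thus
   [w] covers [z] and is an atom of [z, y]. *)
have up e : rank e = k.+1.*2 -> e <= y -> level \bot e k.*2.+1 a ->
    level \bot e k.*2.+1 `<=` level z y (rank z).+1.
  move=> re ey ea w ew; have [/andP[_ we] rw] := ew.
  split; last by rewrite rw rz.
  rewrite (le_trans we ey) andbT.
  suff /(covered_byP lfP grP) [] : covered_by z w by [].
  by apply: (even_coatoms_share (y := e) (c := a) k0 re); rewrite ?(coatomsE re).
have eqz e : rank e = k.+1.*2 -> e <= y -> level \bot e k.*2.+1 a ->
    level \bot e k.*2.+1 = level z y (rank z).+1.
  move=> re ey ea; apply: ncard_sub_eq (finite_level _ _ _) (up e re ey ea) _.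
  by rewrite nzy ncard_even_coatoms.
have c'E : level \bot c' k.*2.+1 = [set a; b].
  have ca : level \bot c k.*2.+1 a by split; rewrite ?le0x.
  have c'a : level \bot c' k.*2.+1 a by split; rewrite ?le0x.
  exact: etrans (eqz _ rc' c'y c'a) (etrans (esym (eqz _ rc cy ca)) cE).
exists c', a, b; split=> //.
- by split; rewrite ?le0x.
- by split=> //; rewrite lE.
- by rewrite lE.
- move=> e [/andP[_ ey] re]; rewrite lE // => eE.
  have [/andP[_ ae] _] : level \bot e k.*2.+1 a by rewrite eE; left.
  have : level a y k.+1.*2 e by split; rewrite ?ae.
  by rewrite ayE => -[]; [left|right].
Qed.

(** Passing to the twin is an involution without fixed points on the coatoms, and [involution_pairs]
    splits them into pairs. *)
Lemma odd_coatoms k y : (0 < k)%N -> rank y = k.+1.*2.+1 ->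
  ~~ odd (ncard (coatoms y)) /\
  exists c c' : 'I_(ncard (coatoms y) %/ 2) -> P,
    [/\ injective c, injective c', (forall i j, c i != c' j),
        coatoms y = (range c `|` range c')%classic &
        forall i, exists a b,
          [/\ a != b, rank a = k.*2.+1, rank b = k.*2.+1,
              lower_covers (c i) = [set a; b] &
              lower_covers (c' i) = [set a; b]]].
Proof.
move=> k0 ry.
have fA : finite_set (coatoms y) by rewrite (coatomsE ry); exact: finite_level.
have rkA c : coatoms y c -> rank c = k.+1.*2 by rewrite (coatomsE ry) => -[].
have inA c : c \in fset_set (coatoms y) <-> coatoms y c by rewrite in_fset_set // inE.
pose S : finType := fset_set (coatoms y).
have coatomS (x : S) : coatoms y (val x) by exact/inA/fsvalP.
have /choice [tau tauP] (x : S) : exists x' : S, [/\ x' <> x,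
    exists a b, [/\ a != b, lower_covers (val x) = [set a; b] &
                    lower_covers (val x') = [set a; b]] &
    forall z : S, lower_covers (val z) = lower_covers (val x) -> z = x \/ z = x'].
  have [c' [a [b [c'x /inA c'y [ab xE] c'E uniq]]]] := odd_coatom_twin k0 ry (coatomS x).
  exists [` c'y]%fset; split.
  - by move=> e; move: c'x; rewrite -e eqxx.
  - by exists a, b.
  - move=> z zx; have [|zE|zE] := uniq (val z) (coatomS z).
    + by rewrite zx.
    + by left; exact: val_inj.
    + by right; exact: val_inj.
have tauE (x : S) : lower_covers (val (tau x)) = lower_covers (val x).
  by have [_ [a [b [_ -> ->]]] _] := tauP x.
have tauN (x : S) : tau x <> x by have [] := tauP x.
(* [x] has the lower covers of [tau x], so by uniqueness of twins it is [tau x] or [tau (tau x)];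
   the first is excluded. *)
have tauK : involutive tau.
  by move=> x; have [_ _ /(_ x (esym (tauE x)))[/esym/tauN|]] := tauP (tau x).
have -> : ncard (coatoms y) = #|S| by rewrite /ncard cardfE.
have [oddS [c [cinj cneq csurj]]] := involution_pairs tauK tauN.
split=> //; exists (fun i => val (c i)), (fun i => val (tau (c i))); split.
- by move=> i j /val_inj/cinj.
- by move=> i j /val_inj/(inv_inj tauK)/cinj.
- by move=> i j; rewrite (inj_eq val_inj).
- apply/seteqP; split=> [z /inA zA|z [[i _ <-]|[i _ <-]]] //.
  by have [i [] zE] := csurj [` zA]%fset; [left|right]; exists i; rewrite // -zE.
- move=> i; have [_ [a [b [ab cE c'E]]] _] := tauP (c i).
  have rk e : lower_covers (val (c i)) e -> rank e = k.*2.+1.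
    move=> /(covered_byP lfP grP) [_ re]; apply: succn_inj; rewrite -re.
    exact: rkA (coatomS (c i)).
  by exists a, b; split=> //; apply: rk; rewrite cE; [left|right].
Qed.

(** An element of rank 1 already lies below two coatoms. *)
Lemma coatoms3_ge2 y : rank y = 3 -> (2 <= ncard (coatoms y))%N.
Proof.
move=> ry; rewrite (coatomsE ry).
have [|v vy rv] := @exists_below _ _ lfP grP y 1; first by rewrite ry.
have v0 : v != \bot by rewrite rank_gt0 ?rv.
have v2 : (rank v < 2)%N by rewrite rv.
have := ncard_le (finite_level _ _ _) (level_upper_bottom v0 vy v2 ry).
by rewrite ncard_upper_coatoms.
Qed.

(** Elements of rank 1 are the vertices and those of rank 2 the edges of a graph; its flags,
    collected in [X], are fed to [two_regular_polygons]. *)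
Lemma interval3_polygons y : rank y = 3 ->
  exists (r : nat) (q : 'I_r -> nat),
    [/\ (0 < r)%N, forall i, (2 <= q i)%N &
        interval_isomorphic \bot y (polygons q)].
Proof.
move=> ry.
pose X := [set p : P * P | [/\ level \bot y 1 p.1, level \bot y 2 p.2 & p.1 <= p.2]].
have fX : finite_set X.
  have fl k : finite_set (level \bot y k) by exact: finite_level.
  apply: (sub_finite_set _ (finite_setX (fl 1%N) (fl 2))).
  by move=> p [p1 p2 _].
have inX p : p \in fset_set X <-> X p by rewrite in_fset_set // inE.
pose F : finType := fset_set X.
pose vertex (x : F) := (val x).1; pose edge (x : F) := (val x).2.
have flagX (x : F) : X (val x) by exact/inX/fsvalP.
have mkflag v e : level \bot y 1 v -> level \bot y 2 e -> v <= e ->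
    exists x : F, vertex x = v /\ edge x = e.
  move=> vy ey ve; have /inX xF : X (v, e) by [].
  by exists [` xF]%fset.
have flag_eq (x z : F) : vertex z = vertex x -> edge z = edge x -> z = x.
  move=> h1 h2; apply: val_inj.
  by rewrite [val z]surjective_pairing [val x]surjective_pairing; congr pair.
have nvE v : level \bot y 1 v -> ncard (level v y 2) = 2.
  move=> [/andP[_ vy] rv].
  by rewrite ncard_upper_coatoms ?rv // rank_gt0 // rv.
(* The case m = 0 of the even count: a Sheffer interval of length 2 has two atoms. *)
have neV e : level \bot y 2 e -> ncard (level \bot e 1) = 2.
  by move=> [_ re]; apply: (@ncard_even_coatoms 0).
have /choice [alpha alphaP] (x : F) : exists x' : F, x' <> x /\
    forall z : F, vertex z = vertex x <-> z = x \/ z = x'.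
  have [vy ey ve] := flagX x; rewrite -/(vertex x) -/(edge x) in vy ey ve.
  have ve2 : level (vertex x) y 2 (edge x).
    by case: ey => /andP[_ ey] re; split; rewrite ?ve.
  have [e' e'x lE] := ncard2_other (finite_level _ _ _) (nvE _ vy) ve2.
  have [/andP[ve' e'y] re'] : level (vertex x) y 2 e' by rewrite lE; right.
  have [|x' [vx' ex']] := mkflag _ e' vy _ ve'; first by rewrite /level /= le0x.
  exists x'; split; first by move=> xx'; move: e'x; rewrite -ex' xx' eqxx.
  move=> z; split=> [vz|[->//|->//]].
  have [_ [/andP[_ zy] rz] vez] := flagX z; rewrite -/(vertex z) -/(edge z) in zy rz vez.
  have : level (vertex x) y 2 (edge z) by split; rewrite // -vz vez.
  rewrite lE => -[ez|ez]; [left|right]; apply: flag_eq => //.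
    by rewrite vx'.
  by rewrite ex'.
have /choice [beta betaP] (x : F) : exists x' : F, x' <> x /\
    forall z : F, edge z = edge x <-> z = x \/ z = x'.
  have [vy ey ve] := flagX x; rewrite -/(vertex x) -/(edge x) in vy ey ve.
  have ve2 : level \bot (edge x) 1 (vertex x).
    by case: vy => _ rv; split; rewrite ?le0x.
  have [v' v'x lE] := ncard2_other (finite_level _ _ _) (neV _ ey) ve2.
  have [/andP[_ v'e] rv'] : level \bot (edge x) 1 v' by rewrite lE; right.
  have v'y : level \bot y 1 v'.
    by case: ey => /andP[_ ey] _; split; rewrite // le0x (le_trans v'e).
  have [x' [vx' ex']] := mkflag _ _ v'y ey v'e.
  exists x'; split; first by move=> xx'; move: v'x; rewrite -vx' xx' eqxx.
  move=> z; split=> [ez|[->//|->//]].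
  have [[_ rz] _ vez] := flagX z; rewrite -/(vertex z) -/(edge z) in rz vez.
  have : level \bot (edge x) 1 (vertex z) by split; rewrite // le0x -ez.
  rewrite lE => -[vz|vz]; [left|right]; apply: flag_eq => //.
    by rewrite vx'.
  by rewrite ex'.
have vflag v : level \bot y 1 v -> exists x : F, vertex x = v.
  move=> vy; have [e [e' [_ lE]]] := ncard_eq2 (finite_level _ _ _) (nvE _ vy).
  have [/andP[ve ey] re] : level v y 2 e by rewrite lE; left.
  have [|x [vx _]] := mkflag _ e vy _ ve; last by exists x.
  by rewrite /level /= le0x.
have eflag e : level \bot y 2 e -> exists x : F, edge x = e.
  move=> ey; have [v [v' [_ lE]]] := ncard_eq2 (finite_level _ _ _) (neV _ ey).
  have [/andP[_ ve] rv] : level \bot e 1 v by rewrite lE; left.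
  have [|x [_ ex]] := mkflag v e _ ey ve; last by exists x.
  by case: ey => /andP[_ ey] _; split; rewrite // le0x (le_trans ve).
have [x0 _] : exists x : F, True.
  have [|v vy rv] := @exists_below _ _ lfP grP y 1; first by rewrite ry.
  by have [|x _] := vflag v; [rewrite /level /= le0x | exists x].
have [r [q [g [r0 q2 [vinj vsurj] [einj esurj] incP]]]] := @two_regular_polygons
  F P P alpha beta vertex edge (fun x : F => (alphaP x).2) (fun x : F => (betaP x).2)
  (fun x : F => (alphaP x).1) (fun x : F => (betaP x).1) flag_eq x0.
exists r, q; split=> //.
have vy a : level \bot y 1 (vertex (g a)) by have [] := flagX (g a).
have ey a : level \bot y 2 (edge (g a)) by have [] := flagX (g a).
pose f (a : polygons q) : P := match a with
  | PEmpty => \bot | PVertex a => vertex (g a) | PEdge a => edge (g a)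
  | PWhole => y end.
have fmono : {mono f : a b / (a <= b)%O}.
  have gt_rank (u v : P) : (rank v < rank u)%N -> (u <= v) = false.
    by move=> vu; apply/negP => /(rank_le lfP grP); rewrite leqNgt vu.
  have rb := rank_bot lfP grP.
  have rv a : rank (vertex (g a)) = 1 by case: (vy a).
  have re a : rank (edge (g a)) = 2 by case: (ey a).
  have vley a : vertex (g a) <= y by case: (vy a) => /andP[].
  have eley a : edge (g a) <= y by case: (ey a) => /andP[].
  (* Comparisons from a higher to a lower rank fail on both sides. Three cases remain: two vertices,
     a vertex and an edge, two edges. *)
  case=> [|v|e|] [|w|e'|]; rewrite /f [RHS]/Order.le /=;
    rewrite ?le0x ?lexx ?vley ?eley //;
    try by rewrite gt_rank // ?rb ?rv ?re ?ry.
  - apply/idP/eqP => [/(rank_eq lfP grP)|-> //]; rewrite !rv => /(_ erefl).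
    by move/vinj.
  - apply/idP/orP => [ve|[/eqP->|/eqP->]].
    + have [x [vx ex]] := mkflag _ _ (vy v) (ey e') ve.
      have /incP [->|->] : exists x : F, vertex x = vertex (g v) /\ edge x = edge (g e').
        by exists x.
      * by left.
      * by right.
    + by have [] := flagX (g e').
    + have [x [<- <-]] := (incP (next_index e') e').2 (or_intror erefl).
      by have [] := flagX x.
  - apply/idP/eqP => [/(rank_eq lfP grP)|-> //]; rewrite !re => /(_ erefl).
    by move/einj.
exists f; split=> //; split.
- case=> [|v|e|] _ /=; rewrite in_itv /= !le0x ?lexx //.
  + by case: (vy v) => /andP[].
  + by case: (ey e) => /andP[].
- by move=> a b _ _ fab; apply/le_anti; rewrite -!fmono fab lexx.
- move=> z; rewrite /= in_itv /= => /andP[_ zy].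
  have := rank_le lfP grP zy; rewrite ry.
  case rz: (rank z) => [|[|[|[|//]]]] _.
  + exists (PEmpty q) => //=; apply: (rank_eq lfP grP (le0x z)).
    by rewrite (rank_bot lfP grP).
  + have [|x xz] := vflag z; first by rewrite /level /= le0x.
    by have [a az] := vsurj x; exists (PVertex a); rewrite //= az.
  + have [|x xz] := eflag z; first by rewrite /level /= le0x.
    by have [a az] := esurj x; exists (PEdge a); rewrite //= az.
  + exists (PWhole q) => //=; symmetry; apply: (rank_eq lfP grP zy).
    by rewrite ry.
Qed.

End EulerianSheffer.

(** * The values of the coatom function and the structure of the coatoms *)

Theorem theorem3p11 (d : Order.disp_t) (P : bPOrderType d) (B D : nat -> nat) :
  sheffer_poset P -> eulerian P ->
  is_binomial_factorial P B -> is_sheffer_factorial P D ->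
  B 0 = 1 -> (forall n, 1 <= n -> B n = 2 ^ (n - 1)) ->
  let C := coatom_function D in
  [/\ (2%:R <= C 3%N)%R /\
      (forall y : P, is_n_interval 3 \bot%O y ->
         exists (r : nat) (q : 'I_r -> nat),
           [/\ 0 < r, forall i, 2 <= q i &
               interval_isomorphic \bot%O y (polygons q)]),
      (forall m, 2 <= m ->
         C (2 * m) = 2%:R%R /\
         forall y : P, is_n_interval (2 * m) \bot%O y ->
           exists c c' : P,
             [/\ c != c', coatoms y = [set c; c']%classic &
                 forall z : P, rank z = 2 * m - 2 ->
                   (covered_by z c <-> covered_by z c')]) &
      (forall m, 2 <= m ->
         exists h : nat,
           [/\ C (2 * m + 1) = h%:R%R, 0 < h, ~~ odd h &
             forall y : P, is_n_interval (2 * m + 1) \bot%O y ->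
               exists c c' : 'I_(h %/ 2) -> P,
                 [/\ injective c, injective c', (forall i j, c i != c' j),
                     coatoms y = (range c `|` range c')%classic &
                     forall i, exists a b : P,
                       [/\ a != b, rank a = 2 * m - 1, rank b = 2 * m - 1,
                           lower_covers (c i) = [set a; b]%classic &
                           lower_covers (c' i) = [set a; b]%classic ] ] ])].
Proof.
move=> shP euP binB shD _ Bexp C.
have lfP := sheffer_locally_finite shP; have grP := sheffer_graded shP.
have rankE n (y : P) : is_n_interval n \bot%O y <-> rank y = n.
  rewrite /is_n_interval (rank_bot lfP grP) add0n le0x.
  by split=> [[]|].
(* [C] is a ratio of factorials, so evaluating it requires an actual interval of each length; the
   infinite chain supplies one. *)
have rankX n : exists y : P, rank y = n.
  exact: exists_rank lfP grP n (sheffer_infinite_chain shP).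
have cfE n (y : P) : rank y = n.+2 -> C n.+2 = (ncard (coatoms y))%:R%R.
  exact: coatom_function_ncard.
split.
- split; last by move=> y /rankE; exact: interval3_polygons shP euP binB Bexp _.
  have [y ry] := rankX 3.
  by rewrite (cfE _ _ ry) ler_nat; exact: coatoms3_ge2 shP binB Bexp _ ry.
- case=> [|[|k]] // _; have mE : 2 * k.+2 = k.+2.*2 by rewrite mul2n.
  rewrite mE; split.
    have [y ry] := rankX k.+2.*2.
    have ry' : rank y = k.*2.+2.+2 by [].
    have -> : k.+2.*2 = k.*2.+2.+2 by [].
    rewrite (cfE _ _ ry') (coatomsE shP ry').
    by rewrite (ncard_even_coatoms shP euP binB Bexp ry).
  move=> y /rankE ry.
  have [c [c' [cc' cE share]]] := even_coatoms shP euP binB Bexp (ltn0Sn k) ry.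
  by exists c, c'.
- case=> [|[|k]] // _; have mE : 2 * k.+2 + 1 = k.+2.*2.+1 by rewrite mul2n addn1.
  have mE' : 2 * k.+2 - 1 = k.+1.*2.+1 by rewrite mul2n doubleS subn1.
  rewrite mE mE'; have [y0 ry0] := rankX k.+2.*2.+1.
  have odd0 := odd_coatoms shP euP binB Bexp (ltn0Sn k).
  have cfE' (y : P) : rank y = k.+2.*2.+1 -> C k.+2.*2.+1 = (ncard (coatoms y))%:R%R.
    by rewrite doubleS; exact: cfE.
  (* The number h is read off one interval of length 2m + 1; any other has as many coatoms, since
     both counts equal the same value of [C]. *)
  exists (ncard (coatoms y0)); split.
  + exact: cfE'.
  + have [c [_ cc]] : exists c, interval_coatoms \bot%O y0 c.
      apply: (lower_cover_exists lfP).
      by rewrite lt_neqAle le0x eq_sym (rank_gt0 shP) ?ry0.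
    have /(ncard_le _) : ([set c] `<=` coatoms y0)%classic by move=> _ ->.
    by rewrite ncard1; apply; rewrite (coatomsE shP ry0); exact: finite_level.
  + by have [] := odd0 _ ry0.
  + move=> y /rankE ry.
    have -> : ncard (coatoms y0) = ncard (coatoms y).
      by apply/eqP; rewrite -(eqr_nat rat) -!cfE'.
    by have [_] := odd0 _ ry.
Qed.
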